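(* Let $\mathbb{X}$ be a category with finite products. For pre-$\mathsf{D}$-sequences $f_\bullet:A\to B$ and $g_\bullet:B\to C$: (i) $\mathsf{T}(i_\bullet)=i_\bullet$ (with $i_\bullet$ on the left the identity of $A$ and on the right the identity of $A\times A$); (ii) $\mathsf{T}(f_\bullet\ast g_\bullet)=\mathsf{T}(f_\bullet)\ast\mathsf{T}(g_\bullet)$.
   Context: Composition in diagrammatic order. $\mathsf{P}(A)=A\times A$, $\mathsf{P}(f)=f\times f$. A pre-$\mathsf{D}$-sequence $f_\bullet:A\to B$ is $(f_n)_{n\ge0}$ with $f_n:\mathsf{P}^n(A)\to B$. Tangent $\mathsf{T}(f_\bullet):\mathsf{P}(A)\to\mathsf{P}(B)$, $\mathsf{T}(f_\bullet)_n=\langle\mathsf{P}^n(\pi_0)f_n,f_{n+1}\rangle$, with $\mathsf{T}^n$ its iterate. Identity $i_\bullet:A\to A$: $i_0=1_A$, $i_n=\pi_1\cdots\pi_1:\mathsf{P}^n(A)\to A$ ($n$ projections). Composition $(f_\bullet\ast g_\bullet)_n=\mathsf{T}^n(f_\bullet)_0\,g_n$. *)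

(* Defs.v *)
(* Plain Rocq (no library category theory is installed).
   A category with finite products (binary products + terminal object),
   composition written in DIAGRAMMATIC order: comp f g = "f then g". *)
Set Implicit Arguments.

Record FPCat := {
  ob :> Type;
  hom : ob -> ob -> Type;
  idm : forall A, hom A A;
  comp : forall A B C, hom A B -> hom B C -> hom A C;
  comp_assoc : forall A B C D (f : hom A B) (g : hom B C) (h : hom C D),
      comp (comp f g) h = comp f (comp g h);
  id_comp : forall A B (f : hom A B), comp (idm A) f = f;
  comp_id : forall A B (f : hom A B), comp f (idm B) = f;
  prod : ob -> ob -> ob;
  pi0 : forall A B, hom (prod A B) A;
  pi1 : forall A B, hom (prod A B) B;
  pair : forall X A B, hom X A -> hom X B -> hom X (prod A B);
  pair_pi0 : forall X A B (f : hom X A) (g : hom X B), comp (pair f g) (pi0 A B) = f;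
  pair_pi1 : forall X A B (f : hom X A) (g : hom X B), comp (pair f g) (pi1 A B) = g;
  pair_uniq : forall X A B (h : hom X (prod A B)),
      h = pair (comp h (pi0 A B)) (comp h (pi1 A B));
  term : ob;
  bang : forall A, hom A term;
  bang_uniq : forall A (f g : hom A term), f = g
}.

Arguments hom {_} _ _.
Arguments idm {_} _.
Arguments comp {_ _ _ _} _ _.
Arguments prod {_} _ _.
Arguments pi0 {_} _ _.
Arguments pi1 {_} _ _.
Arguments pair {_ _ _ _} _ _.

Section PreD.
Variable X : FPCat.

Definition P (A : X) : X := prod A A.
Definition Pmap {A B : X} (f : hom A B) : hom (P A) (P B) :=
  pair (comp (pi0 A A) f) (comp (pi1 A A) f).

(* P^n, with P^(n+1)(A) unfolding definitionally to P^n(P(A)) *)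
Fixpoint Pn (n : nat) (A : X) : X :=
  match n with O => A | S m => Pn m (P A) end.
Fixpoint Pnmap (n : nat) {A B : X} (f : hom A B) : hom (Pn n A) (Pn n B) :=
  match n with O => f | S m => Pnmap m (Pmap f) end.

Definition preD (A B : X) : Type := forall n : nat, hom (Pn n A) B.

Definition Tan {A B : X} (f : preD A B) : preD (P A) (P B) :=
  fun n => pair (comp (Pnmap n (pi0 A A)) (f n)) (f (S n)).

Fixpoint Tn (n : nat) {A B : X} (f : preD A B) : preD (Pn n A) (Pn n B) :=
  match n with O => f | S m => Tn m (Tan f) end.

Fixpoint idD_n (n : nat) (A : X) : hom (Pn n A) A :=
  match n with
  | O => idm A
  | S m => comp (idD_n m (P A)) (pi1 A A)
  end.
Definition idD (A : X) : preD A A := fun n => idD_n n A.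

Definition compD {A B C : X} (f : preD A B) (g : preD B C) : preD A C :=
  fun n => comp (Tn n f 0) (g n).

End PreD.

Arguments P {X} A.
Arguments Pmap {X A B} f.
Arguments Pn {X} n A.
Arguments Pnmap {X} n {A B} f.
Arguments preD {X} A B.
Arguments Tan {X A B} f n.
Arguments Tn {X} n {A B} f _.
Arguments idD_n {X} n A.
Arguments idD {X} A n.
Arguments compD {X A B C} f g n.

(* Main.v *)
(* Both identities reduce to naturality.  For (i), [i_n] is natural in its
   object, so the first component of [T(i)_n] is [i_n pi0] and the pair
   collapses to [i_n].  For (ii), the first components agree once we know
   [P^n(pi0) T^n(f)_0 = T^n(T f)_0 P^n(pi0)]: the projection [pi0] is a map of
   pre-D-sequences from [T f] to [f], and such commuting squares are preserved
   by [T], hence by all of its iterates. *)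

Require Import Defs.
From Corelib Require Import ssreflect.

Section PreDSequences.
Variable X : FPCat.

Lemma comp_pair (Y Z A B : X) (h : hom Y Z) (a : hom Z A) (b : hom Z B) :
  comp h (pair a b) = pair (comp h a) (comp h b).
Proof. by rewrite [LHS]pair_uniq !comp_assoc pair_pi0 pair_pi1. Qed.

Lemma pair_eta (Y A B : X) (h : hom Y (prod A B)) :
  pair (comp h (pi0 A B)) (comp h (pi1 A B)) = h.
Proof. by rewrite -pair_uniq. Qed.

Lemma Pmap_pi0 (A B : X) (h : hom A B) :
  comp (Pmap h) (pi0 B B) = comp (pi0 A A) h.
Proof. exact: pair_pi0. Qed.

Lemma Pmap_pi1 (A B : X) (h : hom A B) :
  comp (Pmap h) (pi1 B B) = comp (pi1 A A) h.
Proof. exact: pair_pi1. Qed.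

Lemma Pmap_comp (A B C : X) (a : hom A B) (b : hom B C) :
  Pmap (comp a b) = comp (Pmap a) (Pmap b).
Proof.
by rewrite /Pmap comp_pair -!comp_assoc pair_pi0 pair_pi1 !comp_assoc.
Qed.

Lemma Pnmap_comp n (A B C : X) (a : hom A B) (b : hom B C) :
  Pnmap n (comp a b) = comp (Pnmap n a) (Pnmap n b).
Proof. by elim: n A B C a b => [|n IH] A B C a b //=; rewrite Pmap_comp IH. Qed.

Lemma idD_n_natural n (A B : X) (h : hom A B) :
  comp (Pnmap n h) (idD_n n B) = comp (idD_n n A) h.
Proof.
elim: n A B h => [|n IH] A B h /=; first by rewrite comp_id id_comp.
by rewrite -comp_assoc IH comp_assoc Pmap_pi1 comp_assoc.
Qed.

Lemma Tan_idD (A : X) n : Tan (idD A) n = idD (P A) n.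
Proof. by rewrite /Tan /idD /= idD_n_natural pair_eta. Qed.

(* [h : A' -> A] and [h' : B' -> B] form a map of pre-D-sequences from [f']
   to [f]. *)
Definition preD_square {A B A' B' : X} (h : hom A' A) (h' : hom B' B)
    (f' : preD A' B') (f : preD A B) :=
  forall k, comp (Pnmap k h) (f k) = comp (f' k) h'.

Lemma preD_square_Tan {A B A' B' : X} {h : hom A' A} {h' : hom B' B}
    {f' : preD A' B'} {f : preD A B} :
  preD_square h h' f' f -> preD_square (Pmap h) (Pmap h') (Tan f') (Tan f).
Proof.
move=> sq k; rewrite /Tan comp_pair [RHS]pair_uniq !comp_assoc Pmap_pi0 Pmap_pi1.
rewrite -!(@comp_assoc _ _ _ _ _ (pair _ _)) pair_pi0 pair_pi1 -(sq (S k)).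
by rewrite -comp_assoc -Pnmap_comp Pmap_pi0 Pnmap_comp comp_assoc sq comp_assoc.
Qed.

Lemma preD_square_Tn m {A B A' B' : X} {h : hom A' A} {h' : hom B' B}
    {f' : preD A' B'} {f : preD A B} :
  preD_square h h' f' f ->
  preD_square (Pnmap m h) (Pnmap m h') (Tn m f') (Tn m f).
Proof.
elim: m A B A' B' h h' f' f => [|m IH] A B A' B' h h' f' f sq //=.
exact/IH/preD_square_Tan.
Qed.

Lemma preD_square_pi0_Tan {A B : X} (f : preD A B) :
  preD_square (pi0 A A) (pi0 B B) (Tan f) f.
Proof. by move=> k; rewrite /Tan pair_pi0. Qed.

Lemma Pnmap_pi0_Tn n (A B : X) (f : preD A B) :
  comp (Pnmap n (pi0 A A)) (Tn n f 0) = comp (Tn (S n) f 0) (Pnmap n (pi0 B B)).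
Proof. exact: (preD_square_Tn n (preD_square_pi0_Tan f) 0). Qed.

Lemma Tan_compD (A B C : X) (f : preD A B) (g : preD B C) n :
  Tan (compD f g) n = compD (Tan f) (Tan g) n.
Proof.
by rewrite /Tan /compD /= comp_pair -comp_assoc Pnmap_pi0_Tn comp_assoc.
Qed.

End PreDSequences.

Theorem lemma3p6 (X : FPCat) (A B C : X) (f : preD A B) (g : preD B C) :
  (forall n, Tan (idD A) n = idD (P A) n) /\
  (forall n, Tan (compD f g) n = compD (Tan f) (Tan g) n).
Proof. by split=> n; [exact: Tan_idD | exact: Tan_compD]. Qed.
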